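(* Let $h$ be the translation from terms (and DM-structures) into CL-terms (and CL-structures) defined in the context. For every DM-sequent $\Sigma\Rightarrow\varphi$: $\mathsf{G3DM}\vdash\Sigma\Rightarrow\varphi$ if and only if $\mathsf{G3ip}\text{+}\mathbf{Gem\text{-}at}\vdash h(\Sigma)\Rightarrow h(\varphi)$.
   Context: Let $\Xi=\{p_n\mid n\in\omega\}$ be a denumerable set of propositional variables. The set $\mathcal{T}$ of terms is generated by $\varphi::=p\mid\bot\mid{\sim}\varphi\mid(\varphi\wedge\varphi)\mid(\varphi\vee\varphi)$ with $p\in\Xi$. A DM-structure is a finite multiset of terms; the comma denotes multiset union. A DM-sequent is $\Sigma\Rightarrow\varphi$ with $\Sigma$ a DM-structure and $\varphi$ a term. The calculus $\mathsf{G3DM}$ (with $p\in\Xi$, all Greek lowercase letters arbitrary terms, $\Sigma$ an arbitrary DM-structure) has axioms: $p,\Sigma\Rightarrow p$; ${\sim}p,\Sigma\Rightarrow{\sim}p$; $\bot,\Sigma\Rightarrow\varphi$; $\Sigma\Rightarrow{\sim}\bot$. Rules: from $\varphi,\psi,\Sigma\Rightarrow\chi$ infer $\varphi\wedge\psi,\Sigma\Rightarrow\chi$; from $\Sigma\Rightarrow\varphi$ and $\Sigma\Rightarrow\psi$ infer $\Sigma\Rightarrow\varphi\wedge\psi$; from $\varphi,\Sigma\Rightarrow\chi$ and $\psi,\Sigma\Rightarrow\chi$ infer $\varphi\vee\psi,\Sigma\Rightarrow\chi$; from $\Sigma\Rightarrow\varphi_i$ ($i=1$ or $2$) infer $\Sigma\Rightarrow\varphi_1\vee\varphi_2$;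 from ${\sim}\varphi,\Sigma\Rightarrow\chi$ and ${\sim}\psi,\Sigma\Rightarrow\chi$ infer ${\sim}(\varphi\wedge\psi),\Sigma\Rightarrow\chi$; from $\Sigma\Rightarrow{\sim}\varphi_i$ ($i=1$ or $2$) infer $\Sigma\Rightarrow{\sim}(\varphi_1\wedge\varphi_2)$; from ${\sim}\varphi,{\sim}\psi,\Sigma\Rightarrow\chi$ infer ${\sim}(\varphi\vee\psi),\Sigma\Rightarrow\chi$; from $\Sigma\Rightarrow{\sim}\varphi$ and $\Sigma\Rightarrow{\sim}\psi$ infer $\Sigma\Rightarrow{\sim}(\varphi\vee\psi)$; from $\varphi,\Sigma\Rightarrow\chi$ infer ${\sim}{\sim}\varphi,\Sigma\Rightarrow\chi$; from $\Sigma\Rightarrow\varphi$ infer $\Sigma\Rightarrow{\sim}{\sim}\varphi$. Let $\Xi_2=\{p'\mid p\in\Xi\}$ be a set of new variables, disjoint from $\Xi$. CL-terms $\mathcal{T}^C$ are generated by $\theta::=q\mid\bot\mid(\theta\wedge\theta)\mid(\theta\vee\theta)\mid(\theta\supset\theta)$ with $q\in\Xi\cup\Xi_2$; $\top:=\bot\supset\bot$ and $\neg\theta:=\theta\supset\bot$. A CL-structure $X$ is a finite multiset of CL-terms; a CL-sequent is $X\Rightarrow\theta$ with $\theta$ a CL-term. The calculus $\mathsf{G3ip}\text{+}\mathbf{Gem\text{-}at}$ on CL-sequents has axioms $q,X\Rightarrow q$ ($q$ a propositional variable) and $\bot,X\Rightarrow\theta$, and rules: from $\theta,\delta,X\Rightarrow\gamma$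 infer $\theta\wedge\delta,X\Rightarrow\gamma$; from $X\Rightarrow\theta$ and $X\Rightarrow\delta$ infer $X\Rightarrow\theta\wedge\delta$; from $\theta,X\Rightarrow\gamma$ and $\delta,X\Rightarrow\gamma$ infer $\theta\vee\delta,X\Rightarrow\gamma$; from $X\Rightarrow\theta_i$ ($i=1$ or $2$) infer $X\Rightarrow\theta_1\vee\theta_2$; from $\theta\supset\delta,X\Rightarrow\theta$ and $\delta,X\Rightarrow\gamma$ infer $\theta\supset\delta,X\Rightarrow\gamma$; from $\theta,X\Rightarrow\delta$ infer $X\Rightarrow\theta\supset\delta$; and (Gem-at): from $q,X\Rightarrow\theta$ and $\neg q,X\Rightarrow\theta$ infer $X\Rightarrow\theta$, for $q$ a propositional variable. The translation $h:\mathcal{T}\to\mathcal{T}^C$ is defined by: $h(p)=p$, $h({\sim}p)=p'$, $h(\bot)=\bot$, $h({\sim}\bot)=\top$, $h(\varphi\wedge\psi)=h(\varphi)\wedge h(\psi)$, $h({\sim}(\varphi\wedge\psi))=h({\sim}\varphi)\vee h({\sim}\psi)$, $h(\varphi\vee\psi)=h(\varphi)\vee h(\psi)$, $h({\sim}(\varphi\vee\psi))=h({\sim}\varphi)\wedge h({\sim}\psi)$, $h({\sim}{\sim}\varphi)=h(\varphi)$. For $\Sigma=(\varphi_1,\ldots,\varphi_n)$, $h(\Sigma)=(h(\varphi_1),\ldots,h(\varphi_n))$. In both calculi $\vdash$ means having a derivation from the axioms by the rules. *)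

(* Defs.v *)
From HB Require Import structures.
From mathcomp Require Import all_boot.
From mathcomp Require Import finmap multiset.

Set Implicit Arguments.
Unset Strict Implicit.
Unset Printing Implicit Defensive.

Local Open Scope mset_scope.

(* The variable p_n of Xi is represented by its index n. *)
Inductive term : Type :=
| Var of nat
| Bot
| Neg of term
| And of term & term
| Or of term & term.

(* The variables of CL-terms are the disjoint union of Xi and Xi_2:
   [inl n] is p_n and [inr n] is p_n'. *)
Definition clvar : Type := (nat + nat)%type.

Inductive clterm : Type :=
| CVar of clvar
| CBot
| CAnd of clterm & clterm
| COr of clterm & clterm
| CImp of clterm & clterm.

Definition CTop : clterm := CImp CBot CBot.
Definition CNot (t : clterm) : clterm := CImp t CBot.

(* [{mset T}] needs a choiceType structure on T, obtained here by an encoding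
   into generic trees. *)
Fixpoint term_encode (a : term) : GenTree.tree nat :=
  match a with
  | Var n => GenTree.Leaf n
  | Bot => GenTree.Node 0 [::]
  | Neg a => GenTree.Node 1 [:: term_encode a]
  | And a b => GenTree.Node 2 [:: term_encode a; term_encode b]
  | Or a b => GenTree.Node 3 [:: term_encode a; term_encode b]
  end.

Fixpoint term_decode (t : GenTree.tree nat) : option term :=
  match t with
  | GenTree.Leaf n => Some (Var n)
  | GenTree.Node 0 [::] => Some Bot
  | GenTree.Node 1 [:: t] => omap Neg (term_decode t)
  | GenTree.Node 2 [:: t; u] =>
      if term_decode t is Some a then omap (And a) (term_decode u) else None
  | GenTree.Node 3 [:: t; u] =>
      if term_decode t is Some a then omap (Or a) (term_decode u) else None
  | _ => None
  end.

Lemma term_encodeK : pcancel term_encode term_decode.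
Proof. by elim=> //= [a -> | a -> b -> | a -> b ->]. Qed.

HB.instance Definition _ := Countable.copy term (pcan_type term_encodeK).

Fixpoint clterm_encode (t : clterm) : GenTree.tree clvar :=
  match t with
  | CVar q => GenTree.Leaf q
  | CBot => GenTree.Node 0 [::]
  | CAnd t u => GenTree.Node 1 [:: clterm_encode t; clterm_encode u]
  | COr t u => GenTree.Node 2 [:: clterm_encode t; clterm_encode u]
  | CImp t u => GenTree.Node 3 [:: clterm_encode t; clterm_encode u]
  end.

Fixpoint clterm_decode (t : GenTree.tree clvar) : option clterm :=
  match t with
  | GenTree.Leaf q => Some (CVar q)
  | GenTree.Node 0 [::] => Some CBot
  | GenTree.Node 1 [:: t; u] =>
      if clterm_decode t is Some a then omap (CAnd a) (clterm_decode u) else None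
  | GenTree.Node 2 [:: t; u] =>
      if clterm_decode t is Some a then omap (COr a) (clterm_decode u) else None
  | GenTree.Node 3 [:: t; u] =>
      if clterm_decode t is Some a then omap (CImp a) (clterm_decode u) else None
  | _ => None
  end.

Lemma clterm_encodeK : pcancel clterm_encode clterm_decode.
Proof. by elim=> //= [t -> u -> | t -> u -> | t -> u ->]. Qed.

HB.instance Definition _ := Countable.copy clterm (pcan_type clterm_encodeK).

(* [G3DM S a] : the DM-sequent S => a is derivable. *)
Inductive G3DM : {mset term} -> term -> Prop :=
| DM_var p S : G3DM (Var p +` S) (Var p)
| DM_negvar p S : G3DM (Neg (Var p) +` S) (Neg (Var p))
| DM_bot S a : G3DM (Bot +` S) a
| DM_negbot S : G3DM S (Neg Bot)
| DM_andL a b S c :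
    G3DM (a +` (b +` S)) c -> G3DM (And a b +` S) c
| DM_andR a b S :
    G3DM S a -> G3DM S b -> G3DM S (And a b)
| DM_orL a b S c :
    G3DM (a +` S) c -> G3DM (b +` S) c -> G3DM (Or a b +` S) c
| DM_orR1 a b S : G3DM S a -> G3DM S (Or a b)
| DM_orR2 a b S : G3DM S b -> G3DM S (Or a b)
| DM_negandL a b S c :
    G3DM (Neg a +` S) c -> G3DM (Neg b +` S) c -> G3DM (Neg (And a b) +` S) c
| DM_negandR1 a b S : G3DM S (Neg a) -> G3DM S (Neg (And a b))
| DM_negandR2 a b S : G3DM S (Neg b) -> G3DM S (Neg (And a b))
| DM_negorL a b S c :
    G3DM (Neg a +` (Neg b +` S)) c -> G3DM (Neg (Or a b) +` S) c
| DM_negorR a b S :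
    G3DM S (Neg a) -> G3DM S (Neg b) -> G3DM S (Neg (Or a b))
| DM_negnegL a S c : G3DM (a +` S) c -> G3DM (Neg (Neg a) +` S) c
| DM_negnegR a S : G3DM S a -> G3DM S (Neg (Neg a)).

(* [G3ip_Gem_at X t] : the CL-sequent X => t is derivable. *)
Inductive G3ip_Gem_at : {mset clterm} -> clterm -> Prop :=
| CL_var q X : G3ip_Gem_at (CVar q +` X) (CVar q)
| CL_bot X t : G3ip_Gem_at (CBot +` X) t
| CL_andL t d X c :
    G3ip_Gem_at (t +` (d +` X)) c -> G3ip_Gem_at (CAnd t d +` X) c
| CL_andR t d X :
    G3ip_Gem_at X t -> G3ip_Gem_at X d -> G3ip_Gem_at X (CAnd t d)
| CL_orL t d X c :
    G3ip_Gem_at (t +` X) c -> G3ip_Gem_at (d +` X) c ->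
    G3ip_Gem_at (COr t d +` X) c
| CL_orR1 t d X : G3ip_Gem_at X t -> G3ip_Gem_at X (COr t d)
| CL_orR2 t d X : G3ip_Gem_at X d -> G3ip_Gem_at X (COr t d)
| CL_impL t d X c :
    G3ip_Gem_at (CImp t d +` X) t -> G3ip_Gem_at (d +` X) c ->
    G3ip_Gem_at (CImp t d +` X) c
| CL_impR t d X : G3ip_Gem_at (t +` X) d -> G3ip_Gem_at X (CImp t d)
| CL_Gem_at q X t :
    G3ip_Gem_at (CVar q +` X) t -> G3ip_Gem_at (CNot (CVar q) +` X) t ->
    G3ip_Gem_at X t.

(* The clauses of h are not structurally recursive (h (Neg (And a b)) calls
   h (Neg a)), so h is defined together with hneg a = h (Neg a); the defining
   clauses for negated terms are recovered by [h_negE]. *)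
Fixpoint h (a : term) : clterm :=
  match a with
  | Var p => CVar (inl p)
  | Bot => CBot
  | Neg a => hneg a
  | And a b => CAnd (h a) (h b)
  | Or a b => COr (h a) (h b)
  end
with hneg (a : term) : clterm :=
  match a with
  | Var p => CVar (inr p)
  | Bot => CTop
  | Neg a => h a
  | And a b => COr (hneg a) (hneg b)
  | Or a b => CAnd (hneg a) (hneg b)
  end.

Lemma h_negE :
  (forall p, h (Neg (Var p)) = CVar (inr p)) *
  (h (Neg Bot) = CTop) *
  (forall a b, h (Neg (And a b)) = COr (h (Neg a)) (h (Neg b))) *
  (forall a b, h (Neg (Or a b)) = CAnd (h (Neg a)) (h (Neg b))) *
  (forall a, h (Neg (Neg a)) = h a).
Proof. by []. Qed.

Definition hS (S : {mset term}) : {mset clterm} := seq_mset (map h S).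

Lemma hS_cons a S : hS (a +` S) = h a +` hS S.
Proof.
rewrite /hS -mset_cons; apply/eq_seq_msetP.
rewrite -map_cons; apply: perm_map.
by rewrite -{1}(seq_mset_id S) -mset_cons perm_eq_seq_mset.
Qed.

Lemma hS0 : hS mset0 = mset0.
Proof. by rewrite /hS enum_mset0; apply/msetP=> x; rewrite mset_seqE mset0E. Qed.

(* Main.v *)
Require Import Defs.
From mathcomp Require Import all_boot.
From mathcomp Require Import finmap multiset.

(** Both calculi capture the same semantic consequence relation, so a Boolean
    semantics mediates between them.

    From left to right, each axiom and rule of [G3DM] is sent by [h] to an axiom
    or rule of the same shape (a negated conjunction or disjunction becomes the
    dual positive connective, a double negation disappears), and the axiom for
    [Neg Bot] becomes the derivable [X => CTop].

    From right to left, [G3ip_Gem_at] is sound for two-valued valuations of the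
    variables p and p', these being valued independently
    ([G3ip_Gem_at_sound]).  Hence it is enough to derive in [G3DM] every sequent
    whose translation is two-valued valid ([G3DM_complete]).  The left rules of
    [G3DM] preserve validity from conclusion to premises, so they reduce the
    problem to antecedents made of literals, an occurrence of [Bot] being closed
    off by its axiom.  The valuation which
    makes true exactly the literals of such an antecedent is then a model of it,
    hence of the succedent.  As the h-image of the succedent is built from
    variables and [CBot], [CTop] by conjunction and disjunction only, its truth
    under this one valuation can be read off as a derivation by right rules
    ([G3DM_right]).  In particular a valid disjunction over
    a literal antecedent has a valid disjunct, which is why single succedents
    suffice although the semantics is classical. *)

Local Open Scope mset_scope.

Lemma forall_in_mset1D (K : choiceType) (P : K -> bool) x (A : {mset K}) :
  (forall y, y \in x +` A -> P y) <-> P x /\ (forall y, y \in A -> P y).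
Proof.
split=> [H|[Px PA] y].
  by split=> [|y Ay]; apply: H; rewrite in_mset1D ?eqxx ?Ay ?orbT.
by rewrite in_mset1D => /orP[/eqP->|/PA].
Qed.

Fixpoint eval (v : clvar -> bool) (t : clterm) : bool :=
  match t with
  | CVar q => v q
  | CBot => false
  | CAnd t u => eval v t && eval v u
  | COr t u => eval v t || eval v u
  | CImp t u => eval v t ==> eval v u
  end.

Lemma G3ip_Gem_at_sound X t (v : clvar -> bool) :
  G3ip_Gem_at X t -> (forall u, u \in X -> eval v u) -> eval v t.
Proof.
elim=> {X t} /=.
- by move=> q X /forall_in_mset1D[].
- by move=> X t /forall_in_mset1D[].
- move=> t d X c _ IH /forall_in_mset1D[/andP[vt vd] vX].
  by apply: IH; apply/forall_in_mset1D; split=> //; apply/forall_in_mset1D.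
- by move=> t d X _ IHt _ IHd vX; rewrite IHt // IHd.
- move=> t d X c _ IHt _ IHd /forall_in_mset1D[/orP[vt|vd] vX].
    by apply: IHt; apply/forall_in_mset1D.
  by apply: IHd; apply/forall_in_mset1D.
- by move=> t d X _ IH vX; rewrite IH.
- by move=> t d X _ IH vX; rewrite IH // orbT.
- move=> t d X c _ IHt _ IHd vtdX.
  (* The left premise keeps the implication, so the whole assumption on the
     antecedent is reused to make [t] true. *)
  have /forall_in_mset1D[/implyP vtd vX] := vtdX.
  by apply: IHd; apply/forall_in_mset1D; split=> //; apply/vtd/IHt.
- by move=> t d X _ IH vX; apply/implyP=> vt; apply/IH/forall_in_mset1D.
- move=> q X t _ IHpos _ IHneg vX.
  by case vq: (v q); [apply: IHpos | apply: IHneg]; apply/forall_in_mset1D;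
    split=> //=; rewrite vq.
Qed.

Definition models (v : clvar -> bool) (S : {mset term}) : Prop :=
  forall b, b \in S -> eval v (h b).

Definition valid (S : {mset term}) (c : term) : Prop :=
  forall v, models v S -> eval v (h c).

Lemma models_mset1D v a S : models v (a +` S) <-> eval v (h a) /\ models v S.
Proof. exact: forall_in_mset1D (fun b => eval v (h b)) a S. Qed.

(** [Neg Bot] counts as a literal since it has no left rule; it is harmless,
    being true under every valuation. *)
Definition literal (a : term) : bool :=
  match a with Var _ | Neg (Var _) | Neg Bot => true | _ => false end.

Definition literal_val (S : {mset term}) (q : clvar) : bool :=
  match q with inl p => Var p \in S | inr p => Neg (Var p) \in S end.

Lemma models_literal_val S :
  (forall b, b \in S -> literal b) -> models (literal_val S) S.
Proof. by move=> litS b Sb; case: b Sb (litS b Sb) => //= [] []. Qed.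

(** The two halves must be proved together, since [h] and [hneg] are mutually
    recursive through [Neg]. *)
Lemma G3DM_right S a :
  (eval (literal_val S) (h a) -> G3DM S a) /\
  (eval (literal_val S) (hneg a) -> G3DM S (Neg a)).
Proof.
elim: a => [p||a [IHa IHna]|a [IHa IHna] b [IHb IHnb]|a [IHa IHna] b [IHb IHnb]] /=.
- split=> Sp; rewrite -(msetB1K Sp); first exact: DM_var.
  exact: DM_negvar.
- by split=> // _; apply: DM_negbot.
- by split=> // /IHa; apply: DM_negnegR.
- split; first by case/andP=> /IHa ? /IHb ?; apply: DM_andR.
  by case/orP=> [/IHna|/IHnb] ?; [apply: DM_negandR1 | apply: DM_negandR2].
- split; first by case/orP=> [/IHa|/IHb] ?; [apply: DM_orR1 | apply: DM_orR2].
  by case/andP=> /IHna ? /IHnb ?; apply: DM_negorR.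
Qed.

Lemma valid_of_models_sub S S' c :
  valid S c -> (forall v, models v S' -> models v S) -> valid S' c.
Proof. by move=> valSc S'S v /S'S; apply: valSc. Qed.

(** Literals are moved to a separate part [L] of the antecedent, so that
    [T] can be decomposed completely by induction on its elements. *)
Definition complete_over_literals (c : term) (T : {mset term}) : Prop :=
  forall L, (forall b, b \in L -> literal b) ->
    valid (T `+` L) c -> G3DM (T `+` L) c.

Lemma complete_literal c l T : literal l ->
  complete_over_literals c T -> complete_over_literals c (l +` T).
Proof.
move=> litl complT L litL; rewrite -msetDA msetDCA; apply: complT.
exact/forall_in_mset1D.
Qed.

(** Validity passes from the conclusion of each left rule to its premises.
    With [T] universally quantified in the induction on [a], the induction
    hypotheses chain when a rule puts two terms in the antecedent: once [b] may
    be added to [T], [a] may be added to [b +` T].  This makes the induction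
    structural, although a left rule can turn one term into two.  Treating [a]
    and [Neg a] together supplies the hypotheses for the rules on negated
    compounds. *)
Lemma complete_mset1D c a T : complete_over_literals c T ->
  complete_over_literals c (a +` T) /\ complete_over_literals c (Neg a +` T).
Proof.
elim: a T => [p||a IH|a IHa b IHb|a IHa b IHb] T complT.
- by split; apply: complete_literal.
- split; last exact: complete_literal.
  by move=> L _ _; rewrite -msetDA; apply: DM_bot.
- have [compla complna] := IH _ complT; split=> // L litL valL.
  rewrite -msetDA; apply: DM_negnegL; rewrite msetDA; apply: compla => //.
  apply: valid_of_models_sub valL _ => v; rewrite -!msetDA.
  by move=> /models_mset1D vaT; apply/models_mset1D.
- have [complb complnb] := IHb _ complT.
  have [_ complna] := IHa _ complT.
  split=> L litL valL; rewrite -msetDA.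
    apply: DM_andL; rewrite 2!msetDA -(msetDA [mset a]).
    apply: (IHa _ complb).1 => //; apply: valid_of_models_sub valL _ => v.
    rewrite -!msetDA => /models_mset1D[va /models_mset1D[vb vT]].
    by apply/models_mset1D; split=> //=; rewrite va.
  apply: DM_negandL; rewrite msetDA; [apply: complna | apply: complnb] => //;
    apply: valid_of_models_sub valL _ => v; rewrite -!msetDA => /models_mset1D[/= vab vT];
    by apply/models_mset1D; split=> //=; rewrite vab ?orbT.
- have [complb complnb] := IHb _ complT.
  have [compla _] := IHa _ complT.
  split=> L litL valL; rewrite -msetDA.
    apply: DM_orL; rewrite msetDA; [apply: compla | apply: complb] => //;
      apply: valid_of_models_sub valL _ => v; rewrite -!msetDA => /models_mset1D[/= vab vT];
      by apply/models_mset1D; split=> //=; rewrite vab ?orbT.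
  apply: DM_negorL; rewrite 2!msetDA -(msetDA [mset Neg a]).
  apply: (IHa _ complnb).2 => //; apply: valid_of_models_sub valL _ => v.
  rewrite -!msetDA => /models_mset1D[/= va /models_mset1D[/= vb vT]].
  by apply/models_mset1D; split=> //=; rewrite va.
Qed.

Lemma G3DM_complete S c : valid S c -> G3DM S c.
Proof.
suff complS : complete_over_literals c S.
  by have := complS mset0; rewrite msetD0; apply=> b; rewrite in_mset0.
rewrite -(seq_mset_id S); elim: (S : seq term) => [|a s IHs]; last first.
  by rewrite mset_cons; apply: (complete_mset1D _ _ _ IHs).1.
have -> : seq_mset [::] = mset0 :> {mset term}.
  by apply/msetP=> x; rewrite mset_seqE mset0E.
move=> L litL; rewrite mset0D => valL.
exact: (G3DM_right L c).1 (valL _ (models_literal_val _ litL)).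
Qed.

Lemma mem_hS S t : t \in hS S -> exists2 b, b \in S & t = h b.
Proof. by rewrite /hS (perm_mem (perm_eq_seq_mset _)) => /mapP. Qed.

Lemma G3DM_translate S a : G3DM S a -> G3ip_Gem_at (hS S) (h a).
Proof.
elim=> {S a} /=.
- by move=> p S; rewrite hS_cons; apply: CL_var.
- by move=> p S; rewrite hS_cons; apply: CL_var.
- by move=> S a; rewrite hS_cons; apply: CL_bot.
- by move=> S; apply/CL_impR/CL_bot.
- by move=> a b S c _; rewrite !hS_cons => IH; apply: CL_andL.
- by move=> a b S _ IHa _ IHb; apply: CL_andR.
- by move=> a b S c _ + _; rewrite !hS_cons => IHa IHb; apply: CL_orL.
- by move=> a b S _ IH; apply: CL_orR1.
- by move=> a b S _ IH; apply: CL_orR2.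
- by move=> a b S c _ + _; rewrite !hS_cons => IHa IHb; apply: CL_orL.
- by move=> a b S _ IH; apply: CL_orR1.
- by move=> a b S _ IH; apply: CL_orR2.
- by move=> a b S c _; rewrite !hS_cons => IH; apply: CL_andL.
- by move=> a b S _ IHa _ IHb; apply: CL_andR.
- by move=> a S c _; rewrite !hS_cons.
- by [].
Qed.

Theorem theorem5p16 (S : {mset term}) (a : term) :
  G3DM S a <-> G3ip_Gem_at (hS S) (h a).
Proof.
split; first exact: G3DM_translate.
move=> derh; apply: G3DM_complete => v vS.
by apply: G3ip_Gem_at_sound derh _ => _ /mem_hS[b /vS vb ->].
Qed.
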